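(* Let $a,b,p,q$ be complex numbers with $p\neq 0$, $q\neq 0$, and let $(W_j)$, $(U_j)$ be as defined in the context. If $r$, $s$ and $t$ are any integers and $m$ and $n$ are non-negative integers, then \[ \sum_{k = 0}^n \binom{m - n + k}{k}U_{r + s}^k U_s^{n - k} W_{t + r(n - k)} = \sum_{k = 0}^n ( - q^s)^{n - k} \binom{m + 1}{k} U_{r + s}^k U_r^{n - k} W_{t - s(n - k)}. \]
   Context: The Horadam sequence $W_j=W_j(a,b;p,q)$ is defined by $W_0=a$, $W_1=b$, $W_j=pW_{j-1}-qW_{j-2}$ for $j\ge 2$, and extended to negative indices by $W_{-j}=\frac{1}{q}(pW_{-j+1}-W_{-j+2})$. The Lucas sequence of the first kind is $U_j=W_j(0,1;p,q)$ (so $U_0=0$, $U_1=1$). For a complex number $x$ and a non-negative integer $k$, $\binom{x}{k}=x(x-1)\cdots(x-k+1)/k!$ (so the upper index may be negative). *)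

(* Defs.v *)
From mathcomp Require Import all_boot all_order all_algebra.

Set Implicit Arguments.
Unset Strict Implicit.
Unset Printing Implicit Defensive.

Import GRing.Theory.
Local Open Scope ring_scope.

Section Horadam.
Variables (F : fieldType) (a b p q : F).

Fixpoint horadam_nat (j : nat) : F :=
  match j with
  | 0 => a
  | 1 => b
  | (j1.+1 as j2).+1 => p * horadam_nat j2 - q * horadam_nat j1
  end.

(* [horadam_opp j] is $W_{-j}$; the case j = 1 is
   $W_{-1} = (p W_0 - W_1) / q$. *)
Fixpoint horadam_opp (j : nat) : F :=
  match j with
  | 0 => a
  | 1 => q^-1 * (p * a - b)
  | (j1.+1 as j2).+1 => q^-1 * (p * horadam_opp j2 - horadam_opp j1)
  end.

(* [Negz j] is the integer -(j + 1). *)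
Definition horadam (j : int) : F :=
  match j with
  | Posz j => horadam_nat j
  | Negz j => horadam_opp j.+1
  end.

End Horadam.

Definition lucasU (F : fieldType) (p q : F) (j : int) : F :=
  horadam 0 1 p q j.

(* Unlike ['C(n, k)], the upper index is an arbitrary field element. *)
Definition gbinom (F : fieldType) (x : F) (k : nat) : F :=
  (\prod_(i < k) (x - i%:R)) / k`!%:R.

(* Main.v *)
(** Let [E] be the shift of the index of [W]. On solutions of the recurrence,
    [U_s E^r + q^s U_r E^(-s) = U_(r+s)]. Writing [x = U_s E^r],
    [y = - q^s U_r E^(-s)] and [z = U_(r+s)], so that [x = y + z], both sides
    [S_n] of the theorem, as functions of [t], satisfy
    [S_(n+1) = y S_n + binom(m+1, n+1) z^(n+1) W]: the right-hand side
    immediately, the left-hand side by Pascal's rule, which first gives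
    [(x - z) S_n] in place of [y S_n]. *)
Require Import Defs.
From mathcomp Require Import all_boot all_order all_algebra.
From mathcomp Require Import reals complex.
From mathcomp Require Import ring zify.

Set Implicit Arguments.
Unset Strict Implicit.
Unset Printing Implicit Defensive.

Import GRing.Theory.
Local Open Scope ring_scope.

Definition lucas_rec (F : fieldType) (p q : F) (X : int -> F) : Prop :=
  forall j : int, X (j + 1 + 1) = p * X (j + 1) - q * X j.

Section Recurrence.
Variables (F : fieldType) (p q : F).
Hypothesis q_neq0 : q != 0.

Lemma horadamN (a b : F) (j : nat) :
  horadam a b p q (- j%:Z) = horadam_opp a b p q j.
Proof. by case: j => [|j] //; rewrite -NegzE. Qed.

Lemma horadam_rec (a b : F) : lucas_rec p q (horadam a b p q).
Proof.
(* The cases are [j >= 0], [j = -1], where both branches of the definition meet, and [j <= -2]. *)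
case=> [j|[|j]].
- by rewrite -!PoszD !addn1.
- by rewrite /=; field.
have -> : Negz j.+1 + 1 + 1 = - j%:Z by rewrite NegzE; lia.
have -> : Negz j.+1 + 1 = - j.+1%:Z by rewrite NegzE; lia.
by rewrite NegzE !horadamN /=; field.
Qed.

Lemma lucas_rec_shift (X : int -> F) (c : int) :
  lucas_rec p q X -> lucas_rec p q (fun j => X (c + j)).
Proof. by move=> recX j; rewrite !addrA recX. Qed.

Lemma lucas_rec_scale (X : int -> F) (c : F) :
  lucas_rec p q X -> lucas_rec p q (fun j => c * X j).
Proof. by move=> recX j; rewrite recX; ring. Qed.

Lemma lucas_rec_add (X Y : int -> F) :
  lucas_rec p q X -> lucas_rec p q Y -> lucas_rec p q (fun j => X j + Y j).
Proof. by move=> recX recY j; rewrite recX recY; ring. Qed.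

(** Reversing the index swaps the outer terms of the recurrence; multiplying by [q ^ (j + 1)]
    restores its shape. *)
Lemma lucas_rec_reflect (X : int -> F) (c : int) :
  lucas_rec p q X -> lucas_rec p q (fun j => q ^ j * X (c - j)).
Proof.
move=> recX j; have := recX (c - (j + 1 + 1)).
have -> : c - (j + 1 + 1) + 1 = c - (j + 1) by ring.
have -> : c - (j + 1) + 1 = c - j by ring.
by rewrite !(expfzDr _ _ q_neq0) !expr1z => ->; ring.
Qed.

Lemma lucas_rec_unique (X Y : int -> F) :
  lucas_rec p q X -> lucas_rec p q Y -> X 0 = Y 0 -> X 1 = Y 1 -> X =1 Y.
Proof.
move=> recX recY eq0 eq1 j.
suff [] : X j = Y j /\ X (j + 1) = Y (j + 1) by [].
elim/int_ind: j => [|j [IH0 IH1]|j [IH0 IH1]].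
- by rewrite add0r.
- by rewrite -addn1 PoszD recX recY IH0 IH1.
have := recX (- j.+1%:Z); have := recY (- j.+1%:Z).
have -> : - j.+1%:Z + 1 = - j%:Z by lia.
rewrite IH0 IH1 => -> /addrI/oppr_inj/(mulfI q_neq0) ->.
by [].
Qed.

(** The operator identity applied to [W] at [t]. It follows from uniqueness of solutions used twice:
    in [s] with [r = 1], then in [r]. *)
Lemma horadam_addition (a b : F) (r s t : int) :
  lucasU p q s * horadam a b p q (t + r)
  = lucasU p q (r + s) * horadam a b p q t
    + - q ^ s * lucasU p q r * horadam a b p q (t - s).
Proof.
set W := horadam a b p q; set U := lucasU p q.
have recW : lucas_rec p q W by exact: horadam_rec.
have recU : lucas_rec p q U by exact: horadam_rec.
have r1 : U s * W (t + 1) + q ^ s * W (t - s) = W t * U (1 + s).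
  rewrite mulrC; move: s; apply: lucas_rec_unique.
  - apply: lucas_rec_add; first exact: lucas_rec_scale.
    exact: lucas_rec_reflect.
  - by apply/lucas_rec_scale/lucas_rec_shift.
  - by rewrite expr0z subr0 addr0 /U /lucasU /=; ring.
  (* At [s = 1], with [U 2 = p], the claim is the recurrence of [W] at [t - 1]. *)
  - have := recW (t - 1); rewrite subrK => ->.
    by rewrite expr1z /U /lucasU /=; ring.
(* In this form both sides solve the recurrence in [r], and [r1] is the initial value at [r = 1]. *)
suff : U s * W (t + r) + (q ^ s * W (t - s)) * U r = W t * U (s + r).
  by rewrite (addrC s r) => /(canRL (addrK _)) ->; ring.
move: r; apply: lucas_rec_unique.
- apply: lucas_rec_add; last exact: lucas_rec_scale.
  by apply/lucas_rec_scale/lucas_rec_shift.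
- by apply/lucas_rec_scale/lucas_rec_shift.
- by rewrite !addr0 /U /lucasU /=; ring.
- by rewrite (addrC s) -r1 /U /lucasU /= mulr1.
Qed.

End Recurrence.

Section BinomialSums.
Variable F : numFieldType.

Lemma gbinom0 (x : F) : gbinom x 0 = 1.
Proof. by rewrite /gbinom big_ord0 fact0 divr1. Qed.

(** With the common product [x (x - 1) ... (x - k + 1)] factored out, this is [(x + 1) / (k + 1) =
    (x - k) / (k + 1) + 1]. *)
Lemma gbinomS (x : F) (k : nat) :
  gbinom (x + 1) k.+1 = gbinom x k.+1 + gbinom x k.
Proof.
rewrite /gbinom big_ord_recl [X in _ = X / _ + _]big_ord_recr /=.
under eq_bigr => i _ do rewrite /bump /= natrD addrKA.
rewrite factS natrM.
have k1_neq0 : k.+1%:R != 0 :> F by rewrite Num.Theory.pnatr_eq0.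
have kf_neq0 : k`!%:R != 0 :> F by rewrite Num.Theory.pnatr_eq0 -lt0n fact_gt0.
by move: k1_neq0; rewrite -natr1 => k1_neq0; field; rewrite k1_neq0 kf_neq0.
Qed.

Variables (W : int -> F) (x y z : F) (r s : int).
Hypothesis W_addition : forall t, x * W (t + r) = z * W t + y * W (t - s).

(** Here [x], [y], [z] are only the scalar parts of the operators; the shifts appear in the index of
    [W]. *)
Let lhs (M : F) (n : nat) (t : int) : F :=
  \sum_(k < n.+1) gbinom (M - n%:R + k%:R) k
    * z ^+ k * x ^+ (n - k) * W (t + r * (n - k)%N%:Z).

Let rhs (M : F) (n : nat) (t : int) : F :=
  \sum_(k < n.+1) gbinom (M + 1) k
    * z ^+ k * y ^+ (n - k) * W (t - s * (n - k)%N%:Z).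

Let rhsS (M : F) (n : nat) (t : int) :
  rhs M n.+1 t = y * rhs M n (t - s) + gbinom (M + 1) n.+1 * z ^+ n.+1 * W t.
Proof.
rewrite /rhs big_ord_recr /= subnn expr0 mulr1 mulr0 subr0; congr (_ + _).
rewrite mulr_sumr; apply: eq_bigr => k _.
rewrite (subSn (ltnSE (ltn_ord k))) exprS.
have -> : t - s - s * (n - k)%N%:Z = t - s * (n - k).+1%:Z.
  by rewrite -[(n - k).+1]addn1 PoszD; ring.
by ring.
Qed.

Let lhsS_pascal (M : F) (n : nat) (t : int) :
  lhs M n.+1 t = x * lhs M n (t + r) - z * lhs M n t
                 + gbinom (M + 1) n.+1 * z ^+ n.+1 * W t.
Proof.
(* This is [lhs M n.+1 t] with every upper index raised by one; its last term has upper index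
   [M + 1]. *)
have sum_split : \sum_(k < n.+2) gbinom (M - n%:R + k%:R) k
    * z ^+ k * x ^+ (n.+1 - k) * W (t + r * (n.+1 - k)%N%:Z)
  = x * lhs M n (t + r) + gbinom (M + 1) n.+1 * z ^+ n.+1 * W t.
  rewrite big_ord_recr /= subnn expr0 mulr1 mulr0 addr0 -natr1.
  rewrite addrA subrK; congr (_ + _).
  rewrite mulr_sumr; apply: eq_bigr => k _.
  rewrite (subSn (ltnSE (ltn_ord k))) exprS.
  have -> : t + r + r * (n - k)%N%:Z = t + r * (n - k).+1%:Z.
    by rewrite -[(n - k).+1]addn1 PoszD; ring.
  by ring.
(* The terms at [k = 0] agree. For the others, Pascal's rule leaves a difference that, reindexed
   from [k + 1] to [k], is [z * lhs M n t]. *)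
rewrite addrAC -sum_split {1}/lhs big_ord_recl.
rewrite [X in _ = X - _]big_ord_recl -[RHS]addrA !gbinom0.
congr (_ + _); rewrite /lhs mulr_sumr -sumrB; apply: eq_bigr => k _.
rewrite lift0 subSS.
have -> : M - n.+1%:R + k.+1%:R = M - n%:R + k%:R by rewrite -!natr1; ring.
by rewrite -(natr1 k) addrA gbinomS exprS; ring.
Qed.

Let lhsS (M : F) (n : nat) (t : int) :
  lhs M n.+1 t = y * lhs M n (t - s) + gbinom (M + 1) n.+1 * z ^+ n.+1 * W t.
Proof.
rewrite lhsS_pascal; congr (_ + _).
rewrite /lhs !mulr_sumr -sumrB; apply: eq_bigr => k _.
(* Termwise, [x E^r - z] becomes [y E^(-s)] at the index [t + j]. *)
set j := r * _; have := W_addition (t + j).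
rewrite (addrAC t j r) (addrAC t j (- s)) => Wadd.
transitivity (gbinom (M - n%:R + k%:R) k * z ^+ k * x ^+ (n - k)
              * (x * W (t + r + j) - z * W (t + j))); first by ring.
by rewrite Wadd; ring.
Qed.

Lemma gbinom_shift_sum (M : F) (n : nat) (t : int) :
  \sum_(k < n.+1) gbinom (M - n%:R + k%:R) k
    * z ^+ k * x ^+ (n - k) * W (t + r * (n - k)%N%:Z)
  = \sum_(k < n.+1) gbinom (M + 1) k
    * z ^+ k * y ^+ (n - k) * W (t - s * (n - k)%N%:Z).
Proof.
rewrite -[LHS]/(lhs M n t) -[RHS]/(rhs M n t).
elim: n t => [|n IHn] t; last by rewrite lhsS rhsS IHn.
by rewrite /lhs /rhs !big_ord1 !gbinom0 !sub0n !mulr0 oppr0.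
Qed.

End BinomialSums.

Theorem theorem1 (R : realType) (a b p q : R[i]) (hp : p != 0) (hq : q != 0)
    (r s t : int) (m n : nat) :
  let W := horadam a b p q in
  let U := lucasU p q in
  \sum_(k < n.+1) gbinom (m%:R - n%:R + k%:R : R[i]) k
      * U (r + s) ^+ k * U s ^+ (n - k) * W (t + r * (n - k)%N%:Z)
  = \sum_(k < n.+1) (- q ^ s) ^+ (n - k) * gbinom (m%:R + 1 : R[i]) k
      * U (r + s) ^+ k * U r ^+ (n - k) * W (t - s * (n - k)%N%:Z).
Proof.
move=> W U.
(* Unification sets [x = U s], [y = - q ^ s * U r], [z = U (r + s)]; it remains to split the powers
   of [y]. *)
rewrite (gbinom_shift_sum (fun t' => horadam_addition p hq a b r s t')).
by apply: eq_bigr => k _; rewrite -/U -/W exprMn; ring.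
Qed.
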